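(* Let $M$ be a finitely generated, left cancellative monoid which is strongly $\delta$-hyperbolic with respect to some finite generating set (for some real $\delta\ge 0$). Then the word problem for $M$ lies in $\mathcal{NP}$.
   Context: Directed graphs may have loops and multiple edges; $d(u,v)$ is the length of a shortest directed path from $u$ to $v$ ($\infty$ if none). Out-ball $\overrightarrow{\mathcal{B}}_r(x)=\{y : d(x,y)\le r\}$, in-ball $\overleftarrow{\mathcal{B}}_r(x)=\{y : d(y,x)\le r\}$, extended to sets of vertices by union. A path $[x_0,\dots,x_n]$ (edge from $x_i$ to $x_{i+1}$) of length $n$ is a geodesic if $n=d(x_0,x_n)$. A directed geodesic triangle is an ordered triple $(p,q,r)$ of geodesics with the end of $p$ equal to the start of $q$, and the concatenation $p\circ q$ having the same start and end as $r$. It is $\delta$-thin if every vertex of $r$ lies in $\overrightarrow{\mathcal{B}}_\delta(p)\cup\overleftarrow{\mathcal{B}}_\delta(q)$, every vertex of $p$ lies in $\overrightarrow{\mathcal{B}}_\delta(r)\cup\overleftarrow{\mathcal{B}}_\delta(q)$, and every vertex of $q$ lies in $\overrightarrow{\mathcal{B}}_\delta(p)\cup\overleftarrow{\mathcal{B}}_\delta(r)$. A directed graph is strongly $\delta$-hyperbolic if all its directed geodesic triangles are $\delta$-thin. For a monoid $M$ generated by a finite set $A$, the right Cayley graph has vertex set $M$ and an edge $m\to n$ for each $a\in A$ with $ma=n$; $M$ is strongly $\delta$-hyperbolic with respect to $A$ if this graph is. The word problem asks, given two words over a finite generating set, whether they represent the same element. *)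

(* Defs.v *)
From Stdlib Require Import Reals.
From mathcomp Require Import all_boot.
Set Implicit Arguments. Unset Strict Implicit. Unset Printing Implicit Defensive.

Definition is_monoid (M : Type) (mul : M -> M -> M) (one : M) : Prop :=
  (forall x y z, mul x (mul y z) = mul (mul x y) z) /\
  (forall x, mul one x = x) /\ (forall x, mul x one = x).

Definition left_cancellative (M : Type) (mul : M -> M -> M) : Prop :=
  forall m x y, mul m x = mul m y -> x = y.

Definition word_eval (M : Type) (mul : M -> M -> M) (one : M)
  (A : Type) (gen : A -> M) (w : seq A) : M :=
  foldr (fun a m => mul (gen a) m) one w.

Definition generates (M : Type) (mul : M -> M -> M) (one : M)
  (A : Type) (gen : A -> M) : Prop :=
  forall m, exists w : seq A, word_eval mul one gen w = m.

Section Cayley.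
Variables (M : Type) (mul : M -> M -> M) (A : Type) (gen : A -> M).

Definition cay_edge (x y : M) : Prop := exists a, mul x (gen a) = y.

(* walk starting at x with subsequent vertices p; length = size p,
   endpoint = last x p, vertex list = x :: p *)
Fixpoint is_walk (x : M) (p : seq M) : Prop :=
  match p with
  | [::] => True
  | y :: p' => cay_edge x y /\ is_walk y p'
  end.

Definition dist_le (x y : M) (r : R) : Prop :=
  exists p, is_walk x p /\ last x p = y /\ Rle (INR (size p)) r.

Definition is_geodesic (x : M) (p : seq M) : Prop :=
  is_walk x p /\
  forall q, is_walk x q -> last x q = last x p -> size p <= size q.

Definition in_out_ball (x : M) (p : seq M) (d : R) (v : M) : Prop :=
  exists u, List.In u (x :: p) /\ dist_le u v d.
Definition in_in_ball (x : M) (p : seq M) (d : R) (v : M) : Prop :=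
  exists u, List.In u (x :: p) /\ dist_le v u d.

Definition geodesic_triangle (x : M) (p : seq M) (y : M) (q : seq M)
  (z : M) (r : seq M) : Prop :=
  is_geodesic x p /\ is_geodesic y q /\ is_geodesic z r /\
  last x p = y /\ z = x /\ last z r = last y q.

Definition thin_triangle (d : R) (x : M) (p : seq M) (y : M) (q : seq M)
  (z : M) (r : seq M) : Prop :=
  (forall v, List.In v (z :: r) -> in_out_ball x p d v \/ in_in_ball y q d v) /\
  (forall v, List.In v (x :: p) -> in_out_ball z r d v \/ in_in_ball y q d v) /\
  (forall v, List.In v (y :: q) -> in_out_ball x p d v \/ in_in_ball z r d v).

Definition strongly_hyperbolic (d : R) : Prop :=
  forall x p y q z r, geodesic_triangle x p y q z r -> thin_triangle d x p y q z r.
End Cayley.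

Unset Implicit Arguments.
Record NTM (Sigma : finType) := {
  tm_state : finType;
  tm_tape : finType;
  tm_input : Sigma -> tm_tape;
  tm_blank : tm_tape;
  tm_start : tm_state;
  tm_accept : tm_state;
  (* tm_delta q g q' g' mv : from state q reading g, may go to q',
     write g', and move right (mv = true) or left (mv = false) *)
  tm_delta : tm_state -> tm_tape -> tm_state -> tm_tape -> bool -> bool
}.

Arguments tm_state {Sigma}. Arguments tm_tape {Sigma}. Arguments tm_input {Sigma}.
Arguments tm_blank {Sigma}. Arguments tm_start {Sigma}. Arguments tm_accept {Sigma}.
Arguments tm_delta {Sigma}.
Set Implicit Arguments.
Section NTMsem.
Variables (Sigma : finType) (T : NTM Sigma).

(* configuration: state, reversed left part, head symbol, right part *)
Definition config : Type :=
  (tm_state T * seq (tm_tape T) * tm_tape T * seq (tm_tape T))%type.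

Definition init_config (w : seq Sigma) : config :=
  match map (tm_input T) w with
  | [::] => (tm_start T, [::], tm_blank T, [::])
  | g :: r => (tm_start T, [::], g, r)
  end.

Definition tm_step (c c' : config) : Prop :=
  let: (q, l, h, r) := c in
  exists q' g (mv : bool), tm_delta T q h q' g mv /\
    c' = if mv then
           match r with
           | [::] => (q', g :: l, tm_blank T, [::])
           | x :: r' => (q', g :: l, x, r')
           end
         else
           match l with
           | [::] => (q', [::], tm_blank T, g :: r)
           | x :: l' => (q', l', x, g :: r)
           end.

Fixpoint reach (n : nat) (c c' : config) : Prop :=
  match n with
  | 0 => c' = c
  | n'.+1 => exists c'', tm_step c c'' /\ reach n' c'' c'
  end.

Definition accepts_within (w : seq Sigma) (t : nat) : Prop :=
  exists n c, n <= t /\ reach n (init_config w) c /\ c.1.1.1 = tm_accept T.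
End NTMsem.

Definition in_NP (Sigma : finType) (L : seq Sigma -> Prop) : Prop :=
  exists (T : NTM Sigma) (k : nat),
    forall w, L w <-> accepts_within T w ((size w) ^ k + k).

(* word problem w.r.t. generators gen : B -> M; an input pair (u, v)
   is encoded as  u # v  over the alphabet option B, with None = '#' *)
Definition word_problem (M : Type) (mul : M -> M -> M) (one : M)
  (B : finType) (gen : B -> M) : seq (option B) -> Prop :=
  fun s => exists u v : seq B,
    s = map Some u ++ None :: map Some v /\
    word_eval mul one gen u = word_eval mul one gen v.

(* Main.v *)
Require Import Defs.
From Stdlib Require Import Reals.
From HB Require Import structures.
From mathcomp Require Import all_boot boolp zify.

Set Implicit Arguments. Unset Strict Implicit. Unset Printing Implicit Defensive.

(** By left cancellativity, thinness of geodesic triangles is a statement about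
    geodesic words.  A word is reduced to a geodesic one letter at a time, so the
    only triangles to fill are those with a geodesic [p], a short side [s] and a
    geodesic [r] with [p s = r].  Thinness joins every vertex of [r] to some vertex
    of [p] by a short rung; two consecutive rungs and the segment of [p] between
    them form a triangle with two short sides, which thinness fills by a number of
    bounded relations linear in the length of the segment.  Hence equal words are
    joined by polynomially many applications of bounded relations, through words of
    linear length.

    The machine stores the two input words on two tracks, each cell holding a pair
    of words of bounded length, guesses such applications by carrying a bounded pair
    of words between neighbouring cells, and finally compares the tracks.  Every move
    preserves the value of both tracks, which gives soundness; completeness follows
    from the polynomial derivations of both words to the same geodesic. *)

(** Only lengths of walks are compared with the real constant, so a natural number can stand in for
    it from here on. *)
Lemma INR_bounded (d : R) : exists D : nat, forall n, Rle (INR n) d -> n <= D.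
Proof.
have [D dD] := INR_unbounded d.
exists D => n nd; apply/leP/INR_le.
by apply: Rle_trans nd _; apply: Rlt_le.
Qed.

(** * Geodesic words *)

Section CayleyWords.
Variables (M : Type) (mul : M -> M -> M) (one : M).
Hypothesis monM : is_monoid mul one.
Variables (A : Type) (gen : A -> M).

Local Notation "x ** y" := (mul x y) (at level 40, left associativity).
Local Notation ev := (word_eval mul one gen).

Definition geodesic_word (w : seq A) : Prop :=
  forall w', ev w' = ev w -> size w <= size w'.

Definition ball (n : nat) (m : M) : Prop := exists2 w, size w <= n & ev w = m.

(** The starting vertex is left out, matching the convention of [is_walk]. *)
Fixpoint trace (x : M) (w : seq A) : seq M :=
  if w is a :: w' then (x ** gen a) :: trace (x ** gen a) w' else [::].

Lemma mulmA x y z : x ** (y ** z) = x ** y ** z. Proof. by case: monM => + _; apply. Qed.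
Lemma mul1m x : one ** x = x. Proof. by case: monM => _ [+ _]; apply. Qed.
Lemma mulm1 x : x ** one = x. Proof. by case: monM => _ [_ +]; apply. Qed.

Lemma ev_cat u v : ev (u ++ v) = ev u ** ev v.
Proof. by elim: u => [|a u IH] /=; rewrite ?mul1m // IH mulmA. Qed.

Lemma ev1 a : ev [:: a] = gen a. Proof. by rewrite /= mulm1. Qed.

Lemma ball_ev w : ball (size w) (ev w). Proof. by exists w. Qed.

Lemma ball_one n : ball n one. Proof. by exists [::]. Qed.

Lemma ball_gen a : ball 1 (gen a). Proof. by exists [:: a]; rewrite ?ev1. Qed.

Lemma ball_le n n' m : n <= n' -> ball n m -> ball n' m.
Proof. by move=> le_n [w sw wm]; exists w => //; apply: leq_trans le_n. Qed.

Lemma ball_mul n n' m m' : ball n m -> ball n' m' -> ball (n + n') (m ** m').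
Proof.
move=> [w sw <-] [w' sw' <-]; exists (w ++ w'); last exact: ev_cat.
by rewrite size_cat leq_add.
Qed.

Lemma geodesic_ball w n : geodesic_word w -> ball n (ev w) -> size w <= n.
Proof. by move=> gw [w' sw' /gw /leq_trans]; apply. Qed.

Lemma geodesic_prefix u v : geodesic_word (u ++ v) -> geodesic_word u.
Proof.
move=> g w' ew; have := g (w' ++ v); rewrite !ev_cat ew !size_cat leq_add2r.
exact.
Qed.

Lemma geodesic_suffix u v : geodesic_word (u ++ v) -> geodesic_word v.
Proof.
move=> g w' ew; have := g (u ++ w'); rewrite !ev_cat ew !size_cat leq_add2l.
exact.
Qed.

Lemma geodesic_exists m : generates mul one gen ->
  exists2 w, geodesic_word w & ev w = m.
Proof.
move=> /(_ m) [w0 w0m].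
pose P n := `[< exists2 w, size w = n & ev w = m >].
have exP : exists n, P n by exists (size w0); apply/asboolP; exists w0.
case: (ex_minnP exP) => n /asboolP[w sw wm] minn; exists w => // w' w'm.
by rewrite sw; apply: minn; apply/asboolP; exists w'; rewrite // -wm.
Qed.

Lemma size_trace x w : size (trace x w) = size w.
Proof. by elim: w x => //= a w IH x; rewrite IH. Qed.

Lemma last_trace x w : last x (trace x w) = x ** ev w.
Proof. by elim: w x => [|a w IH] x /=; rewrite ?mulm1 // IH mulmA. Qed.

Lemma walk_trace x w : is_walk mul gen x (trace x w).
Proof. by elim: w x => //= a w IH x; split=> //; exists a. Qed.

Lemma walkP x p : is_walk mul gen x p -> exists w, p = trace x w.
Proof.
elim: p x => [|y p IH] x /=; first by exists [::].
by case=> -[a <-] /IH [w ->]; exists (a :: w).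
Qed.

Lemma in_trace x w v :
  List.In v (x :: trace x w) <-> exists w1 w2, w = w1 ++ w2 /\ v = x ** ev w1.
Proof.
split.
  elim: w x => [|a w IH] x.
    by case=> // ->; exists [::], [::]; rewrite mulm1.
  case=> [->|/IH [w1 [w2 [-> ->]]]]; first by exists [::], (a :: w); rewrite mulm1.
  by exists (a :: w1), w2; rewrite /= mulmA.
case=> w1 [w2 [-> ->]]; elim: w1 x => [|a w1 IH] x /=; first by left; rewrite mulm1.
by right; rewrite mulmA; apply: IH.
Qed.

(** * Thin triangles in terms of geodesic words *)

Section LeftCancellative.
Hypothesis lcM : left_cancellative mul.

(** Cancelling [x] turns a competing walk from [x] into a word equal to [w], so being geodesic does
    not depend on the base point. *)
Lemma geodesic_trace x w : geodesic_word w -> is_geodesic mul gen x (trace x w).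
Proof.
move=> gw; split; first exact: walk_trace.
move=> q /walkP [w' ->]; rewrite !last_trace !size_trace => /lcM; exact: gw.
Qed.

Variables (d : R) (D : nat).
Hypothesis dD : forall n, Rle (INR n) d -> n <= D.
Hypothesis hypM : strongly_hyperbolic mul gen d.

Lemma dist_le_ball x y : dist_le mul gen x y d -> exists2 s, ball D s & x ** s = y.
Proof.
move=> [p [/walkP [w ->] []]]; rewrite last_trace size_trace => <- /dD sw.
by exists (ev w) => //; exists w.
Qed.

Section Triangle.
Variables p q r : seq A.
Hypotheses (gp : geodesic_word p) (gq : geodesic_word q) (gr : geodesic_word r).
Hypothesis pqr : ev p ** ev q = ev r.

Lemma triangle_thin :
  thin_triangle mul gen d one (trace one p) (ev p) (trace (ev p) q) one (trace one r).
Proof.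
apply: hypM; do !split; try exact: (proj1 (geodesic_trace _ _)).
- exact: (proj2 (geodesic_trace _ _)).
- exact: (proj2 (geodesic_trace _ _)).
- exact: (proj2 (geodesic_trace _ _)).
- by rewrite last_trace mul1m.
- by rewrite !last_trace mul1m.
Qed.

Lemma thin_third r1 r2 : r = r1 ++ r2 ->
  (exists p1 p2 s, [/\ p = p1 ++ p2, ball D s & ev p1 ** s = ev r1]) \/
  (exists q1 q2 s, [/\ q = q1 ++ q2, ball D s & ev r1 ** s = ev p ** ev q1]).
Proof.
move=> rE; case: triangle_thin => + _.
have rv : List.In (ev r1) (one :: trace one r).
  by apply/in_trace; exists r1, r2; rewrite mul1m.
case/(_ _ rv) => -[u [/in_trace [w1 [w2 [wE ->]]]]].
  rewrite mul1m => /dist_le_ball [s sD <-]; left.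
  by exists w1, w2, s.
by move=> /dist_le_ball [s sD sE]; right; exists w1, w2, s.
Qed.

Lemma thin_first p1 p2 : p = p1 ++ p2 ->
  (exists r1 r2 s, [/\ r = r1 ++ r2, ball D s & ev r1 ** s = ev p1]) \/
  (exists q1 q2 s, [/\ q = q1 ++ q2, ball D s & ev p1 ** s = ev p ** ev q1]).
Proof.
move=> pE; case: triangle_thin => _ [+ _].
have pv : List.In (ev p1) (one :: trace one p).
  by apply/in_trace; exists p1, p2; rewrite mul1m.
case/(_ _ pv) => -[u [/in_trace [w1 [w2 [wE ->]]]]].
  rewrite mul1m => /dist_le_ball [s sD <-]; left.
  by exists w1, w2, s.
by move=> /dist_le_ball [s sD sE]; right; exists w1, w2, s.
Qed.

End Triangle.

(* A long prefix of [p] is out of reach of the short third side, so it must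
   lie close to the short second side; shorter prefixes are handled by going
   forward along [p] until that happens. *)
Lemma suffix_product_ball K p p1 p2 s :
  generates mul one gen -> geodesic_word p -> ball K s -> ball K (ev p ** s) ->
  p = p1 ++ p2 -> ball (2 * K + 2 * D + 1) (ev p2 ** s).
Proof.
move=> genM gp sK psK pE.
have [q gq qs] := geodesic_exists s genM.
have [r gr rE] := geodesic_exists (ev p ** s) genM.
have sq : size q <= K by apply: (geodesic_ball gq); rewrite qs.
have sr : size r <= K by apply: (geodesic_ball gr); rewrite rE.
have far u v : p = u ++ v -> K + D < size u -> ball (D + K) (ev v ** s).
  move=> uvE su.
  have pqr : ev p ** ev q = ev r by rewrite qs rE.
  case: (thin_first gp gq gr pqr uvE) => -[w1 [w2 [t [wE tD]]]].
    move=> w1t.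
    have gu : geodesic_word u by apply: (@geodesic_prefix _ v); rewrite -uvE.
    have : size u <= size w1 + D.
      by apply: (geodesic_ball gu); rewrite -w1t; apply: ball_mul (ball_ev _) tD.
    move: sr; rewrite wE size_cat; lia.
  (* Cancelling [u] from the rung equation gives [t = v w1], hence [v s = t w2] with [w2] a suffix
     of the short word [q]. *)
  rewrite uvE ev_cat -mulmA => /lcM tE.
  rewrite -qs wE ev_cat mulmA -tE; apply: ball_mul => //.
  by exists w2 => //; move: sq; rewrite wE size_cat; lia.
have [lt_p1|le_p1] := ltnP (K + D) (size p1).
  by apply: ball_le (far _ _ pE lt_p1); lia.
have [lt_p|le_p] := ltnP (K + D) (size p).
  (* Advancing [j <= K + D + 1] letters brings the prefix just beyond the threshold [K + D];
     together with the bound [D + K] of [far] this makes [2 * K + 2 * D + 1]. *)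
  set j := (K + D).+1 - size p1.
  have p2E : p2 = take j p2 ++ drop j p2 by rewrite cat_take_drop.
  have sj : size (take j p2) = j.
    by rewrite size_take; move: lt_p; rewrite pE size_cat /j; case: ifP; lia.
  rewrite p2E ev_cat -mulmA.
  apply: (@ball_le (j + (D + K))); first by rewrite /j; lia.
  apply: ball_mul; first by rewrite -{1}sj; apply: ball_ev.
  apply: (far (p1 ++ take j p2)); first by rewrite -catA cat_take_drop.
  by rewrite size_cat sj /j; lia.
apply: (@ball_le (size p2 + K)); last by apply: ball_mul => //; apply: ball_ev.
by move: le_p; rewrite pE size_cat; lia.
Qed.

(** A vertex of [r] more than [D + K] before its end cannot be close to the short side, since a
    detour through that side would shorten the geodesic [r]; so it is reached from [p]. A later
    vertex takes the rung of the last such vertex, prolonged by at most [D + K + 1] letters of [r].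
    If [r] itself is short, the rung starts at the identity. *)
Lemma prefix_shadow K p s r r1 r2 :
  generates mul one gen -> geodesic_word p -> geodesic_word r -> ball K s ->
  ev p ** s = ev r -> r = r1 ++ r2 ->
  exists p1 p2 t, [/\ p = p1 ++ p2, ball (2 * D + K + 1) t & ev p1 ** t = ev r1].
Proof.
move=> genM gp gr sK psr rE.
have [q gq qs] := geodesic_exists s genM.
have sq : size q <= K by apply: (geodesic_ball gq); rewrite qs.
have far u v : r = u ++ v -> D + K < size v ->
    exists p1 p2 t, [/\ p = p1 ++ p2, ball D t & ev p1 ** t = ev u].
  move=> uvE sv.
  have pqr : ev p ** ev q = ev r by rewrite qs psr.
  case: (thin_third gp gq gr pqr uvE) => // -[q1 [q2 [t [qE tD tE]]]].
  have gv : geodesic_word v by apply: (@geodesic_suffix u); rewrite -uvE.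
  have : size v <= D + size q2.
    apply: (geodesic_ball gv); suff -> : ev v = t ** ev q2.
      by apply: ball_mul tD (ball_ev _).
    apply: (@lcM (ev u)); rewrite -ev_cat -uvE mulmA tE -mulmA -ev_cat -qE.
    by rewrite pqr.
  by move: sq; rewrite qE size_cat; lia.
have [lt_r2|le_r2] := ltnP (D + K) (size r2).
  have [p1 [p2 [t [pE tD tE]]]] := far _ _ rE lt_r2.
  by exists p1, p2, t; split=> //; apply: ball_le tD; lia.
have [lt_r|le_r] := ltnP (D + K) (size r); last first.
  exists [::], p, (ev r1); split=> //; last exact: mul1m.
  by apply: ball_le (ball_ev _); move: le_r; rewrite rE size_cat; lia.
set j := size r - (D + K).+1.
have jr1 : j <= size r1 by rewrite /j rE size_cat; lia.
have uvE : r = take j r1 ++ (drop j r1 ++ r2) by rewrite catA cat_take_drop.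
have [|p1 [p2 [t [pE tD tE]]]] := far _ _ uvE.
  by move: lt_r; rewrite size_cat size_drop /j rE size_cat; lia.
exists p1, p2, (t ** ev (drop j r1)); split=> //.
  apply: ball_le (ball_mul tD (ball_ev _)).
  by rewrite size_drop; move: lt_r; rewrite /j rE size_cat; lia.
by rewrite mulmA tE -ev_cat cat_take_drop.
Qed.

End LeftCancellative.
End CayleyWords.
(** * Local rewriting of cell lists *)

Section Derivation.
Variables (M : Type) (mul : M -> M -> M) (one : M).
Hypothesis monM : is_monoid mul one.
Variables (W : Type) (val : W -> M) (e : W).
Hypothesis val_e : val e = one.

Local Notation "x ** y" := (mul x y) (at level 40, left associativity).

(* [der N m s t]: at most [m] local steps lead from [s] to [t] through lists
   of at most [N] cells. *)
Inductive der (N : nat) : nat -> seq W -> seq W -> Prop :=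
| der_refl s : size s <= N -> der N 0 s s
| der_weaken m m' s t : der N m s t -> m <= m' -> der N m' s t
| der_trans m m' s t u : der N m s t -> der N m' t u -> der N (m + m') s u
| der_sym m s t : der N m s t -> der N m t s
| der_pair x c d c' d' y : val c ** val d = val c' ** val d' ->
    size x + size y + 2 <= N -> der N 1 (x ++ c :: d :: y) (x ++ c' :: d' :: y)
| der_insert x y : size x + size y < N -> der N 1 (x ++ y) (x ++ e :: y).

Lemma der_context N N' m s t x y : der N m s t -> N + size x + size y <= N' ->
  der N' m (x ++ s ++ y) (x ++ t ++ y).
Proof.
move=> dst leN; elim: dst => {m s t}.
- by move=> s sN; apply: der_refl; rewrite !size_cat; lia.
- by move=> m m' s t _ IH lem; apply: der_weaken IH lem.
- by move=> m m' s t u _ IH1 _ IH2; apply: der_trans IH1 IH2.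
- by move=> m s t _ IH; apply: der_sym.
- move=> x' c d c' d' y' cd sN; rewrite -!catA /= !(catA x).
  by apply: der_pair => //; rewrite !size_cat; lia.
- move=> x' y' sN; rewrite -!catA /= !(catA x).
  by apply: der_insert; rewrite !size_cat; lia.
Qed.

Lemma der_mono N N' m m' s t : der N m s t -> N <= N' -> m <= m' -> der N' m' s t.
Proof.
move=> d leN lem; apply: (der_weaken _ lem).
by have := @der_context N N' m s t [::] [::] d; rewrite !cats0; apply; rewrite /=; lia.
Qed.

Lemma der_prefix N N' m s t x : der N m s t -> N + size x <= N' ->
  der N' m (x ++ s) (x ++ t).
Proof.
move=> d leN; have := @der_context N N' m s t x [::] d; rewrite !cats0; apply.
by rewrite /=; lia.
Qed.

Lemma der_merge N x c d f y : val c ** val d = val f ->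
  size x + size y + 2 <= N -> der N 2 (x ++ c :: d :: y) (x ++ f :: y).
Proof.
move=> cdf sN; apply: (@der_trans _ 1 1 _ (x ++ e :: f :: y)).
  by apply: der_pair => //; rewrite val_e (mul1m monM).
by apply: der_sym; apply: der_insert => /=; lia.
Qed.

(** Local steps act on two neighbouring cells, so a lone cell is changed with the help of an
    inserted [e]; hence [2 <= N]. *)
Lemma der_cell N c c' : val c = val c' -> 2 <= N -> der N 3 [:: c] [:: c'].
Proof.
move=> cc' N2; apply: (@der_trans _ 1 2 _ [:: e; c]).
  exact: (@der_insert _ [::] [:: c]).
by apply: (@der_merge _ [::] _ _ _ [::]) => //; rewrite val_e (mul1m monM).
Qed.

End Derivation.

(** * Filling triangles by local steps *)

Section HyperbolicDerivation.
Variables (M : Type) (mul : M -> M -> M) (one : M).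
Hypothesis monM : is_monoid mul one.
Hypothesis lcM : left_cancellative mul.
Variables (A : Type) (gen : A -> M).
Hypothesis genM : generates mul one gen.
Variables (d : R) (D : nat).
Hypothesis dD : forall n, Rle (INR n) d -> n <= D.
Hypothesis hypM : strongly_hyperbolic mul gen d.
Variables (W : Type) (val : W -> M) (e : W) (letter : A -> W).
Hypothesis val_e : val e = one.
Hypothesis val_letter : forall a, val (letter a) = gen a.
Variable K0 : nat.

Local Notation "x ** y" := (mul x y) (at level 40, left associativity).
Local Notation ev := (word_eval mul one gen).
Local Notation ball := (ball mul one gen).
Local Notation geodesic_word := (geodesic_word mul one gen).
Local Notation der := (der mul val e).
(** [K1] allows for a rung, of length at most [2 * D + K0 + 1], followed by one letter. [K] is the
    bound of [suffix_product_ball] for short sides of length [K1]; it is the capacity needed of a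
    cell. *)
Local Notation K1 := (2 * D + K0 + 2).
Local Notation K := (2 * K1 + 2 * D + 1).

Hypothesis cell_of_ball : forall m, ball K m -> exists c, val c = m.

(** The letters of [p] are absorbed into the last cell from right to left. Each intermediate value
    is a suffix of [p] times [s], which fits in a cell by [suffix_product_ball]. *)
Lemma der_collapse p s t : geodesic_word p -> ball K1 (val s) -> ball K1 (val t) ->
  ev p ** val s = val t ->
  der (size p + 2) (2 * size p + 3) (map letter p ++ [:: s]) [:: t].
Proof.
move=> gp sK tK pst.
have : forall p1 p2, p = p1 ++ p2 -> ball K (ev p2 ** val s).
  move=> p1 p2; apply: (suffix_product_ball monM lcM dD hypM genM gp sK).
  by rewrite pst.
elim: p t pst {gp tK} => [|a p IH] t pst sufK.
  by apply: (der_cell monM val_e) => //=; rewrite -pst /= (mul1m monM).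
have [t' t'E] := cell_of_ball (sufK [:: a] p erefl).
have dp : der (size p + 2) (2 * size p + 3) (map letter p ++ [:: s]) [:: t'].
  by apply: IH => // p1 p2 pE; apply: (sufK (a :: p1)); rewrite pE.
apply: (@der_weaken _ _ _ _ _ _ (2 * size p + 3 + 2)); last by rewrite /=; lia.
apply: (der_trans (t := [:: letter a; t'])).
  have /= := @der_prefix _ _ _ _ _ _ ((size p).+1 + 2) _ _ _ [:: letter a] dp.
  by apply; lia.
apply: (der_merge monM val_e (x := [::]) (y := [::])) => /=; last by lia.
by rewrite t'E val_letter -pst /= (mulmA monM).
Qed.

(* The rungs [t] joining a prefix [p1] of [p] to successive vertices of [r]
   need not advance monotonically along [p]; either way two consecutive rungs
   bound, together with a segment of [p], a triangle with two short sides. *)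
Lemma der_ladder p s r r1 r2 p1 p2 t N :
  geodesic_word p -> geodesic_word r -> ball K0 (val s) -> ev p ** val s = ev r ->
  r = r1 ++ r2 -> p = p1 ++ p2 -> ball (2 * D + K0 + 1) (val t) ->
  ev p1 ** val t = ev r1 -> size p + size r1 + 3 <= N ->
  der N ((size r1).+1 * (2 * size p + 5)) (map letter r1) (map letter p1 ++ [:: t]).
Proof.
move=> gp gr sK psr; elim/last_ind: r1 r2 p1 p2 t N => [|r1 a IH] r2 p1 p2 t N.
  move=> _ pE tK p1t sN.
  (* At the identity the rung closes up, [p1 t = 1]: a cell [e] is inserted and a collapse is run
     backwards from it. *)
  apply: (@der_weaken _ _ _ _ _ _ (1 + (2 * size p1 + 3))); last first.
    by rewrite /= pE size_cat; lia.
  apply: (der_trans (t := [:: e])).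
    by apply: (@der_insert _ _ _ _ _ _ [::] [::]) => /=; lia.
  apply: der_sym; apply: (@der_mono _ _ _ _ _ (size p1 + 2) _ (2 * size p1 + 3)) => //.
    apply: der_collapse.
    - by apply: (@geodesic_prefix _ _ _ monM _ _ _ p2); rewrite -pE.
    - by apply: ball_le tK; lia.
    - by rewrite val_e; apply: ball_one.
    - by rewrite p1t val_e.
  by move: sN; rewrite pE size_cat /=; lia.
rewrite -cats1 -catA /= size_cat /= => rE pE tK p1t sN.
have [q1 [q2 [m [qE mK mE]]]] := prefix_shadow monM lcM dD hypM genM gp gr sK psr rE.
have [u uE] : exists c, val c = m by apply: cell_of_ball; apply: ball_le mK; lia.
(* One cell of the bound is kept free for the next letter [a]. *)
have d1 : der (N - 1) ((size r1).+1 * (2 * size p + 5)) (map letter r1)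
    (map letter q1 ++ [:: u]).
  by apply: (IH (a :: r2) q1 q2) => //; rewrite ?uE //; lia.
have fK : ball K1 (m ** gen a).
  by apply: ball_le (ball_mul monM mK (ball_gen monM gen a)); lia.
(* [f] prolongs the previous rung along [a], so that [f] and [t] end at the same vertex of [r]. *)
have [f fE] : exists c, val c = m ** gen a.
  by apply: cell_of_ball; apply: ball_le fK; lia.
have q1f : ev q1 ** val f = ev p1 ** val t.
  by rewrite fE (mulmA monM) mE p1t ev_cat // ev1.
have tK1 : ball K1 (val t) by apply: ball_le tK; lia.
have fK1 : ball K1 (val f) by rewrite fE.
rewrite map_cat.
apply: (@der_weaken _ _ _ _ _ _
    ((size r1).+1 * (2 * size p + 5) + (2 + (2 * size p + 3)))); last by lia.
apply: (der_trans (t := map letter q1 ++ [:: u; letter a])).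
  have := @der_context _ _ _ _ _ _ N _ _ _ [::] [:: letter a] d1.
  by rewrite /= -catA; apply; lia.
apply: (der_trans (t := map letter q1 ++ [:: f])).
  apply: (der_merge monM val_e); first by rewrite fE uE val_letter.
  by rewrite size_map; move: sN; rewrite qE size_cat /=; lia.
have seg v w : p = v ++ w -> forall z z', w = z ++ z' -> geodesic_word z.
  move=> vwE z z' wE; apply: (@geodesic_prefix _ _ _ monM _ _ _ z').
  by rewrite -wE; apply: (@geodesic_suffix _ _ _ monM _ _ v); rewrite -vwE.
(* In both cases [z] is the segment of [p] between the feet of the rungs. If [p1] is the longer
   prefix, then [z t = f] and the collapse is run backwards; otherwise [z f = t]. *)
have [le_q|/ltnW le_p] := leqP (size q1) (size p1).
  have p1E : p1 = q1 ++ drop (size q1) p1.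
    rewrite -{1}(cat_take_drop (size q1) p1); congr (_ ++ _).
    have : take (size q1) p = take (size q1) p by [].
    by rewrite {1}pE qE takel_cat // take_size_cat.
  set z := drop _ _ in p1E.
  have gz : geodesic_word z by apply: (seg q1 (z ++ p2)) => //; rewrite catA -p1E.
  rewrite p1E map_cat -catA.
  apply: (@der_weaken _ _ _ _ _ _ (2 * size z + 3)).
    apply: der_sym; apply: (der_prefix (der_collapse gz tK1 fK1 _)).
      by apply: (@lcM (ev q1)); rewrite q1f (mulmA monM) -ev_cat // -p1E.
    by rewrite size_map; move: sN; rewrite pE p1E !size_cat /=; lia.
  by rewrite pE p1E !size_cat; lia.
have q1E : q1 = p1 ++ drop (size p1) q1.
  rewrite -{1}(cat_take_drop (size p1) q1); congr (_ ++ _).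
  have : take (size p1) p = take (size p1) p by [].
  by rewrite {1}qE pE takel_cat // take_size_cat.
set z := drop _ _ in q1E.
have gz : geodesic_word z by apply: (seg p1 (z ++ q2)) => //; rewrite catA -q1E.
rewrite q1E map_cat -catA.
apply: (@der_weaken _ _ _ _ _ _ (2 * size z + 3)).
  apply: (der_prefix (der_collapse gz fK1 tK1 _)).
    by apply: (@lcM (ev p1)); rewrite -q1f (mulmA monM) -ev_cat // -q1E.
  by rewrite size_map; move: sN; rewrite qE q1E !size_cat /=; lia.
by rewrite qE q1E !size_cat; lia.
Qed.

(** The ladder along all of [r] ends in a rung [t] from [p1] to the end of [r]. What remains is the
    triangle [p2 s = t], whose sides [s] and [t] are short, and it collapses. *)
Lemma der_triangle p s r N :
  geodesic_word p -> geodesic_word r -> ball K0 (val s) -> ev p ** val s = ev r ->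
  size p + size r + 3 <= N ->
  der N ((size r + 2) * (2 * size p + 5)) (map letter p ++ [:: s]) (map letter r).
Proof.
move=> gp gr sK psr sN.
have rE : r = r ++ [::] by rewrite cats0.
have [p1 [p2 [m [pE mK mE]]]] := prefix_shadow monM lcM dD hypM genM gp gr sK psr rE.
have [t tE] : exists c, val c = m by apply: cell_of_ball; apply: ball_le mK; lia.
have d1 : der N ((size r).+1 * (2 * size p + 5)) (map letter r)
    (map letter p1 ++ [:: t]).
  by apply: (der_ladder gp gr sK psr rE pE) => //; rewrite tE.
apply: (@der_weaken _ _ _ _ _ _ (2 * size p2 + 3 + (size r).+1 * (2 * size p + 5)));
  last by rewrite pE size_cat; lia.
apply: der_trans (der_sym d1); rewrite pE map_cat -catA.
apply: (der_prefix (der_collapse _ _ _ _)).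
- by apply: (@geodesic_suffix _ _ _ monM _ _ p1); rewrite -pE.
- by apply: ball_le sK; lia.
- by rewrite tE; apply: ball_le mK; lia.
- by apply: (@lcM (ev p1)); rewrite tE mE -psr pE ev_cat // (mulmA monM).
- by rewrite size_map; move: sN; rewrite pE size_cat; lia.
Qed.

(** The part already read is kept as a geodesic [p], and one triangle absorbs the next cell. Each
    cell lengthens the geodesic by at most [K0], so [S] bounds all geodesics met. At the end, two
    geodesics for the same element are joined by a triangle with short side [e]. *)
Lemma der_reduce cs p g S : geodesic_word p -> geodesic_word g ->
  (forall c, List.In c cs -> ball K0 (val c)) ->
  ev p ** foldr (fun c m => val c ** m) one cs = ev g ->
  size p + K0 * size cs <= S ->
  der (2 * S + size cs + 4) ((size cs).+1 * ((S + 2) * (2 * S + 5) + 1))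
    (map letter p ++ cs) (map letter g).
Proof.
elim: cs p => [|c cs IH] p gp gg csK pcg sS.
  rewrite cats0 mul1n.
  have sg : size g <= size p.
    apply: (geodesic_ball gg); rewrite -pcg /= (mulm1 monM); exact: ball_ev.
  rewrite /= in sS.
  apply: (@der_weaken _ _ _ _ _ _ (1 + (size g + 2) * (2 * size p + 5))); last first.
    by rewrite addnC leq_add2r leq_mul //; lia.
  apply: (der_trans (t := map letter p ++ [:: e])).
    rewrite -{1}(cats0 (map letter p)); apply: der_insert.
    by rewrite size_map /=; lia.
  apply: der_triangle => //; rewrite ?val_e; first exact: ball_one.
    exact: pcg.
  by rewrite /=; lia.
have [r gr rE] := geodesic_exists (ev p ** val c) genM.
have cK : ball K0 (val c) by apply: csK; left.
have sr : size r <= size p + K0.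
  by apply: (geodesic_ball gr); rewrite rE; apply: ball_mul => //; apply: ball_ev.
rewrite /= in sS.
have dr : der (2 * S + size cs + 4) ((size cs).+1 * ((S + 2) * (2 * S + 5) + 1))
    (map letter r ++ cs) (map letter g).
  apply: IH => //; last by lia.
    by move=> c' c'cs; apply: csK; right.
  by rewrite rE -(mulmA monM).
apply: (@der_weaken _ _ _ _ _ _ ((size r + 2) * (2 * size p + 5) +
    (size cs).+1 * ((S + 2) * (2 * S + 5) + 1))); last first.
  rewrite [X in _ <= X]mulSn leq_add2r addn1 ltnW // ltnS.
  by rewrite leq_mul //; lia.
apply: (der_trans (t := map letter r ++ cs)); last by apply: der_mono dr _ _ => /=; lia.
have dc := der_triangle gp gr cK (esym rE) (leqnn _).
have := @der_context _ _ _ _ _ _ (2 * S + (size cs).+1 + 4) _ _ _ [::] cs dc.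
by rewrite /= -catA; apply; lia.
Qed.

End HyperbolicDerivation.
(** * The nondeterministic machine *)

Inductive control := Start | Mark | ConvertLeft | ConvertRight | Compare | Accept.

Definition control_code (q : control) : nat :=
  match q with
  | Start => 0 | Mark => 1 | ConvertLeft => 2
  | ConvertRight => 3 | Compare => 4 | Accept => 5
  end.

Definition control_decode (n : nat) : control :=
  match n with
  | 0 => Start | 1 => Mark | 2 => ConvertLeft
  | 3 => ConvertRight | 4 => Compare | _ => Accept
  end.

Lemma control_codeK : cancel control_code control_decode. Proof. by case. Qed.

HB.instance Definition _ := Countable.copy control (can_type control_codeK).

Lemma control_enumP :
  Finite.axiom [:: Start; Mark; ConvertLeft; ConvertRight; Compare; Accept].
Proof. by case. Qed.

HB.instance Definition _ := isFinite.Build control control_enumP.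

Section Machine.
Variables (M : Type) (mul : M -> M -> M) (one : M).
Hypothesis monM : is_monoid mul one.
Variables (B : finType) (gen : B -> M).
Variables (W : finType) (val : W -> M) (e : W) (cell : B -> W).
Hypothesis val_e : val e = one.
Hypothesis val_cell : forall b, val (cell b) = gen b.

Local Notation "x ** y" := (mul x y) (at level 40, left associativity).

(** The two tracks form a single word over the product monoid, so one equation tracks both
    values. *)
Definition mul2 (x y : M * M) : M * M := (x.1 ** y.1, x.2 ** y.2).
Definition val2 (c : W * W) : M * M := (val c.1, val c.2).
Local Notation one2 := (one, one).
Local Notation ev2 := (word_eval mul2 one2 val2).
Local Notation ee := (e, e).

Lemma mul2_monoid : is_monoid mul2 one2.
Proof.
by split=> [x y z|]; [|split=> -[x y]];
  rewrite /mul2 /= ?(mulmA monM) ?(mul1m monM) ?(mulm1 monM).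
Qed.

Lemma val2_ee : val2 ee = one2. Proof. by rewrite /val2 /= val_e. Qed.

Lemma ev2_split cs :
  ev2 cs = (word_eval mul one val (unzip1 cs), word_eval mul one val (unzip2 cs)).
Proof. by elim: cs => //= c cs ->. Qed.

(** [inl None] first separates the input words; a new copy written before the input then marks the
    left end of the tape. The blank [inr None] closes the tape on the right. *)
Definition symbol : finType := (option B + option (W * W))%type.
Definition state : finType := (control + bool * (W * W))%type.

Local Notation Letter b := (inl (Some b) : symbol).
Local Notation Hash := (inl None : symbol).
Local Notation Cell c := (inr (Some c) : symbol).
Local Notation Blank := (inr None : symbol).
Local Notation Ctrl q := (inl q : state).
Local Notation Carry b s := (inr (b, s) : state).

(* In state [Carry b s] the pair [s] sits between two tape cells: just left of
   the scanned cell if [b], just right of it otherwise. *)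
Definition beside (b : bool) (s h : W * W) : M * M :=
  if b then mul2 (val2 s) (val2 h) else mul2 (val2 h) (val2 s).

(* The input [u # v] becomes [Hash, cells, Blank], the two components of the
   cells spelling [u] and [v]; these are then rewritten locally, and compared
   cell by cell in a last sweep. *)
Inductive rule : state -> symbol -> state -> symbol -> bool -> Prop :=
| rule_start h : rule (Ctrl Start) h (Ctrl Mark) h false
| rule_mark : rule (Ctrl Mark) Blank (Ctrl ConvertLeft) Hash true
| rule_left b :
    rule (Ctrl ConvertLeft) (Letter b) (Ctrl ConvertLeft) (Cell (cell b, e)) true
| rule_hash : rule (Ctrl ConvertLeft) Hash (Ctrl ConvertRight) (Cell ee) true
| rule_right b :
    rule (Ctrl ConvertRight) (Letter b) (Ctrl ConvertRight) (Cell (e, cell b)) true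
| rule_pad : rule (Ctrl ConvertRight) Blank (Ctrl ConvertRight) (Cell ee) true
| rule_ready : rule (Ctrl ConvertRight) Blank (Carry false ee) Blank false
| rule_rewrite b s h mv s' h' : beside b s h = beside (~~ mv) s' h' ->
    rule (Carry b s) (Cell h) (Carry mv s') (Cell h') mv
| rule_turn : rule (Carry false ee) Hash (Carry true ee) Hash true
| rule_compare : rule (Carry false ee) Hash (Ctrl Compare) Hash true
| rule_equal c : val c.1 = val c.2 ->
    rule (Ctrl Compare) (Cell c) (Ctrl Compare) (Cell c) true
| rule_accept : rule (Ctrl Compare) Blank (Ctrl Accept) Blank true.

Definition machine : NTM (option B) :=
  {| tm_state := state; tm_tape := symbol; tm_input := inl; tm_blank := Blank;
     tm_start := Ctrl Start; tm_accept := Ctrl Accept;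
     tm_delta := fun q h q' h' mv => `[< rule q h q' h' mv >] |}.

(** An empty right part is read as a blank, which merges the two cases of a move to the right. *)
Definition at_head (q : state) (l r : seq symbol) : config machine :=
  if r is h :: r' then (q, l, h, r') else (q, l, Blank, [::]).

Lemma init_at w : init_config machine w = at_head (Ctrl Start) [::] (map inl w).
Proof. by case: w. Qed.

Lemma step_cases (q : state) l (h : symbol) r c :
  @tm_step _ machine (q, l, h, r) c -> exists q' g,
  (rule q h q' g true /\ c = at_head q' (g :: l) r) \/
  (rule q h q' g false /\
   c = if l is x :: l' then at_head q' l' (x :: g :: r)
       else at_head q' [::] (Blank :: g :: r)).
Proof.
case=> q' [g [[] [/asboolP qr ->]]]; exists q', g.
  by left; split=> //; case: r.
by right; split=> //; case: l.
Qed.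

Lemma step_right (q : state) h q' g l r : rule q h q' g true ->
  tm_step (at_head q l (h :: r)) (at_head q' (g :: l) r).
Proof. by move=> qr; exists q', g, true; split; [apply/asboolP|case: r]. Qed.

Lemma step_left q h q' g l x r : rule q h q' g false ->
  tm_step (at_head q (x :: l) (h :: r)) (at_head q' l (x :: g :: r)).
Proof. by move=> qr; exists q', g, false; split; [apply/asboolP|]. Qed.

Lemma step_left_end q h q' g r : rule q h q' g false ->
  tm_step (at_head q [::] (h :: r)) (at_head q' [::] (Blank :: g :: r)).
Proof. by move=> qr; exists q', g, false; split; [apply/asboolP|]. Qed.

(** ** Soundness *)

(** In a carrying state, the cells together with the carried pair multiply to the values of [u] and
    [v]. Over a blank nothing is claimed about them, because no rule applies there and the run is
    stuck. While comparing, [cs] stands for the cells already swept, whose two tracks have equal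
    products. *)
Definition invariant (w : seq (option B)) (c : config machine) : Prop :=
  let: (q, l, h, r) := c in
  match q with
  | inl Start => c = init_config machine w
  | inl Mark => [/\ l = [::], h = Blank & r = map inl w \/ w = [::] /\ r = [:: Blank]]
  | inl ConvertLeft => exists u w', [/\ w = map Some u ++ w',
      l = rev (map (fun b => Cell (cell b, e)) u) ++ [:: Hash] &
      c = at_head q l (map inl w')]
  | inl ConvertRight => exists u v w' cs,
      [/\ w = map Some u ++ None :: map Some v ++ w',
          l = map (fun c => Cell c) (rev cs) ++ [:: Hash],
          ev2 cs = (word_eval mul one gen u, word_eval mul one gen v) &
          c = at_head q l (map inl w')]
  | inl Compare => exists u v cs rs,
      [/\ w = map Some u ++ None :: map Some v,
          h :: r = map (fun c => Cell c) rs ++ [:: Blank],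
          word_eval mul one val (unzip1 cs) = word_eval mul one val (unzip2 cs) &
          ev2 (cs ++ rs) = (word_eval mul one gen u, word_eval mul one gen v)]
  | inl Accept => word_problem mul one gen w
  | inr (b, s) => exists u v, w = map Some u ++ None :: map Some v /\
      [\/ exists ls d rs,
            [/\ l = map (fun c => Cell c) ls ++ [:: Hash], h = Cell d,
                r = map (fun c => Cell c) rs ++ [:: Blank] &
                mul2 (ev2 (rev ls)) (mul2 (beside b s d) (ev2 rs)) =
                  (word_eval mul one gen u, word_eval mul one gen v)],
          exists rs,
            [/\ l = [::], h = Hash, r = map (fun c => Cell c) rs ++ [:: Blank] &
                mul2 (val2 s) (ev2 rs) =
                  (word_eval mul one gen u, word_eval mul one gen v)] |
          h = Blank]
  end.


Lemma invariant_init w : invariant w (init_config machine w).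
Proof. by case: w. Qed.

Lemma invariant_at w (q : state) l r :
  (forall h r', at_head q l r = (q, l, h, r') ->
    invariant w ((q, l, h, r') : config machine)) -> invariant w (at_head q l r).
Proof. by case: r => [|h r]; apply. Qed.

Lemma invariant_step w c c' : invariant w c -> tm_step c c' -> invariant w c'.
Proof.
have A2 := mulmA mul2_monoid; have I1 := mul1m mul2_monoid.
have I2 := mulm1 mul2_monoid; have evc := ev_cat mul2_monoid val2.
case: c => [[[q l] h] r] inv /step_cases [q' [g [] [qr ->]]];
  inversion qr; subst; clear qr; move: inv => /=.
(* First come the ten cases moving right, in the order of [rule], then the three moving left: start,
   ready and rewrite. *)
- move=> [-> _ [->|[-> ->]]].
    by apply: invariant_at => h r' E; exists [::], w.
  by exists [::], [::].
- move=> [u [[|[b'|] w'] [-> -> //]]] /= [-> ->].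
  apply: invariant_at => h r' E; exists (rcons u b'), w'; split=> //.
  + by rewrite map_rcons cat_rcons.
  + by rewrite map_rcons rev_rcons.
- move=> [u [[|[b'|] w'] [-> -> //]]] /= [->].
  apply: invariant_at => h r' E; exists u, [::], w', (rcons (map (fun b => (cell b, e)) u) ee);
    split=> //.
  + by rewrite rev_rcons /= map_rev -map_comp.
  + rewrite -cats1 evc /= I2 val2_ee I2 ev2_split /unzip1 /unzip2 -!map_comp.
    congr pair; elim: (u) => //= b u' ->; first by rewrite val_cell.
    by rewrite val_e (mul1m monM).
- move=> [u [v [[|[b'|] w'] [cs [-> -> cuv //]]]]] /= [-> ->].
  apply: invariant_at => h r' E; exists u, (rcons v b'), w', (rcons cs (e, cell b')); split=> //.
  + by rewrite map_rcons cat_rcons.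
  + by rewrite rev_rcons.
  + rewrite -!cats1 evc /= I2 cuv ev_cat // ev1 // /mul2 /= val_e val_cell.
    by rewrite (mulm1 monM).
- move=> [u [v [[|[b'|] w'] [cs [-> -> cuv //]]]]] /= [->].
  exists u, v, [::], (rcons cs ee); split=> //.
  + by rewrite rev_rcons.
  + by rewrite -cats1 evc /= I2 val2_ee I2.
- move=> [u [v [-> [[ls [d [rs [-> [<-] -> E]]]]|[rs [_ //]]|//]]]].
  case: rs E => [|c rs] E; exists u, v; split=> //; first by constructor 3.
  constructor 1; exists (h' :: ls), c, rs; split=> //.
  by rewrite -E H /= rev_cons -cats1 evc /= I2 !A2.
- move=> [u [v [-> [[ls [d [rs [_ //]]]]|[rs [-> _ -> E]]|//]]]].
  case: rs E => [|c rs] E; exists u, v; split=> //; first by constructor 3.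
  constructor 1; exists [::], c, rs; split=> //.
  by rewrite -E /= I1 A2.
- move=> [u [v [-> [[ls [d [rs [_ //]]]]|[rs [-> _ -> E]]|//]]]].
  apply: invariant_at => h r' hr; exists u, v, [::], rs; split=> //.
    by case: (rs) hr => [|c rs'] [<- <-].
  by rewrite -E val2_ee I1.
- move=> [u [v [cs [[|c0 rs] [-> //= [<- ->] csE E]]]]].
  apply: invariant_at => h r' hr; exists u, v, (rcons cs c), rs; split=> //.
  + by case: (rs) hr => [|c'' rs'] [<- <-].
  + by rewrite /unzip1 /unzip2 !map_rcons -!cats1 !ev_cat // csE /= H.
  + by rewrite cat_rcons.
- move=> [u [v [cs [[|c0 rs] [-> //= _ csE E]]]]].
  suff : word_problem mul one gen (map Some u ++ None :: map Some v) by case: r.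
  exists u, v; split=> //.
  by move: E; rewrite cats0 ev2_split csE => -[<- <-].
- move=> inv; case: w inv => [|o w] [-> -> ->]; split=> //; first by right.
  by left.
- move=> [u [v [[|[b'|] w'] [cs [-> -> cuv //]]]]] /= [->].
  case/lastP: cs cuv => [|cs c] cuv; rewrite ?rev_rcons cats0 /=;
    exists u, v; split=> //.
    constructor 2; exists [::]; split=> //.
    by rewrite val2_ee I1.
  constructor 1; exists (rev cs), c, [::]; split=> //.
  by rewrite revK -cuv -cats1 evc /= val2_ee !I2.
- move=> [u [v [-> [[ls [d [rs [-> [<-] -> E]]]]|[rs [_ //]]|//]]]].
  case: ls E => [|c ls] E; exists u, v; split=> //.
    constructor 2; exists (h' :: rs); split=> //.
    by rewrite -E H /= I1 !A2.
  constructor 1; exists ls, c, (h' :: rs); split=> //.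
  by rewrite -E H /= rev_cons -cats1 evc /= I2 !A2.
Qed.

Lemma machine_sound w t : accepts_within machine w t -> word_problem mul one gen w.
Proof.
move=> [n [c [_ [rc ca]]]].
suff : invariant w c by case: c ca {rc} => [[[q l] h] r] /= ->.
elim: n (init_config _ _) (invariant_init w) rc => [|n IH] c0 inv /=.
  by move=> ->.
by move=> [c1 [/(invariant_step inv) inv1 /IH]]; apply.
Qed.

(** ** Completeness *)

Definition reach_le (n : nat) (c c' : config machine) : Prop :=
  exists2 k, k <= n & reach k c c'.

Lemma reach_le_refl c : reach_le 0 c c. Proof. by exists 0. Qed.

Lemma reach_le_step c c' : tm_step c c' -> reach_le 1 c c'.
Proof. by exists 1 => //; exists c'. Qed.

Lemma reach_le_trans c' n n' c c'' :
  reach_le n c c' -> reach_le n' c' c'' -> reach_le (n + n') c c''.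
Proof.
move=> [k kn rk] [k' kn' rk']; exists (k + k'); first exact: leq_add.
elim: k c {kn} rk => [|k IH] c /=; first by move=> <-.
by move=> [c1 [cc1 /IH]]; exists c1.
Qed.

Lemma reach_le_weaken n n' c c' : n <= n' -> reach_le n c c' -> reach_le n' c c'.
Proof. by move=> le_n [k kn rk]; exists k => //; apply: leq_trans le_n. Qed.

Local Notation cells cs := (map (fun c : W * W => Cell c) cs).

(** The resting point between simulated steps: over the left marker with a trivial carried pair,
    both [rule_turn] and [rule_compare] apply. *)
Definition home (cs : seq (W * W)) : config machine :=
  at_head (Carry false ee) [::] (Hash :: cells cs ++ [:: Blank]).

Lemma reach_right (X : eqType) q (f g : X -> symbol) l r (bs : seq X) :
  (forall b, b \in bs -> rule q (f b) q (g b) true) ->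
  reach_le (size bs) (at_head q l (map f bs ++ r)) (at_head q (map g (rev bs) ++ l) r).
Proof.
elim: bs l => [|b bs IH] l qb; first exact: reach_le_refl.
apply: (@reach_le_trans (at_head q (g b :: l) (map f bs ++ r)) 1).
  by apply/reach_le_step/step_right/qb/mem_head.
rewrite rev_cons map_rcons cat_rcons; apply: IH => b' b'bs.
by apply: qb; rewrite inE b'bs orbT.
Qed.

Lemma reach_home q h g ls r : rule q h (Carry false ee) g false ->
  reach_le (size ls).+1 (at_head q (cells ls ++ [:: Hash]) (h :: r))
    (at_head (Carry false ee) [::] (Hash :: cells (rev ls) ++ g :: r)).
Proof.
elim: ls q h g r => [|c ls IH] q h g r qr.
  exact/reach_le_step/step_left.
apply: (@reach_le_trans
  (at_head (Carry false ee) (cells ls ++ [:: Hash]) (Cell c :: g :: r)) 1).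
  exact/reach_le_step/step_left.
rewrite rev_cons map_rcons cat_rcons; apply: IH; apply: rule_rewrite.
by rewrite /beside /= val2_ee (mul1m mul2_monoid) (mulm1 mul2_monoid).
Qed.

(** The trivial pair is carried up to [c]; there [c] is picked up and [ee] left in its place. Over
    [d] the product is split anew: [d'] is written and [c'] carried back into the vacated cell,
    after which the head returns with the trivial pair. *)
Lemma reach_rewrite xs ys c d c' d' :
  mul2 (val2 c) (val2 d) = mul2 (val2 c') (val2 d') ->
  reach_le (2 * size xs + 4) (home (xs ++ c :: d :: ys)) (home (xs ++ c' :: d' :: ys)).
Proof.
move=> cd.
have I1 := mul1m mul2_monoid; have I2 := mulm1 mul2_monoid.
pose L := cells (rev xs) ++ [:: Hash].
pose R := cells ys ++ [:: Blank].
apply: (@reach_le_weaken (1 + (size xs + (1 + (1 + (size (rev xs)).+1))))).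
  by rewrite size_rev; lia.
apply: (@reach_le_trans (at_head (Carry true ee) [:: Hash]
   (cells xs ++ Cell c :: Cell d :: R))).
  apply: reach_le_step; rewrite /home map_cat -catA /=.
  exact/step_right/rule_turn.
apply: (@reach_le_trans (at_head (Carry true ee) L (Cell c :: Cell d :: R))).
  apply: reach_right => c0 _.
  by apply: rule_rewrite; rewrite /beside /= val2_ee I1 I2.
apply: (@reach_le_trans (at_head (Carry true c) (Cell ee :: L) (Cell d :: R))).
  apply/reach_le_step/step_right/rule_rewrite.
  by rewrite /beside /= val2_ee I1.
apply: (@reach_le_trans (at_head (Carry false c') L (Cell ee :: Cell d' :: R))).
  exact/reach_le_step/step_left/rule_rewrite.
rewrite /home map_cat -catA -{2}(revK xs); apply: reach_home.
by apply: rule_rewrite; rewrite /beside /= val2_ee I1.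
Qed.

Lemma reach_accept cs : (forall c, c \in cs -> val c.1 = val c.2) ->
  exists2 c, reach_le (size cs + 2) (home cs) c & c.1.1.1 = tm_accept machine.
Proof.
move=> cE; exists (at_head (Ctrl Accept) (Blank :: cells (rev cs) ++ [:: Hash]) [::]).
  apply: (@reach_le_weaken (1 + (size cs + 1))); first by lia.
  apply: (@reach_le_trans (at_head (Ctrl Compare) [:: Hash] (cells cs ++ [:: Blank]))).
    exact/reach_le_step/step_right/rule_compare.
  apply: (@reach_le_trans (at_head (Ctrl Compare) (cells (rev cs) ++ [:: Hash]) [:: Blank])).
    by apply: reach_right => c /cE; apply: rule_equal.
  exact/reach_le_step/step_right/rule_accept.
by [].
Qed.

(** The [k] trailing cells are guessed as working space. The two words occupy disjoint ranges of
    cells, and the separator becomes a neutral cell between them. *)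
Lemma reach_convert u v k :
  reach_le (2 * (size u + size v + 1 + k) + 3)
    (init_config machine (map Some u ++ None :: map Some v))
    (home (zip (map cell u ++ nseq (size v + 1 + k) e)
               (nseq (size u + 1) e ++ map cell v ++ nseq k e))).
Proof.
have -> : zip (map cell u ++ nseq (size v + 1 + k) e)
              (nseq (size u + 1) e ++ map cell v ++ nseq k e) =
    map (fun b => (cell b, e)) u ++ ee :: map (fun b => (e, cell b)) v ++ nseq k ee.
  elim: u => [|b u IH]; last by rewrite /= IH.
  rewrite addn1 /=; congr (_ :: _); elim: v => [|b v IH]; last by rewrite /= IH.
  by elim: (k) => //= k' ->.
set w := map Some u ++ _; pose n := size u + size v + 1.
pose l1 := map (fun b => Cell (cell b, e)) (rev u) ++ [:: Hash].
pose l2 := map (fun b => Cell (e, cell b)) (rev v) ++ Cell ee :: l1.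
pose r1 := Hash :: map (fun b => Letter b) v.
apply: (@reach_le_weaken (1 + (1 + (size u + (1 + (size v + (k + (n + k).+1))))))).
  by rewrite /n; lia.
apply: (@reach_le_trans (at_head (Ctrl Mark) [::] (Blank :: map inl w))).
  rewrite init_at /w; case: (u) => [|b u'] /=;
  exact/reach_le_step/step_left_end/rule_start.
apply: (@reach_le_trans (at_head (Ctrl ConvertLeft) [:: Hash] (map inl w))).
  exact/reach_le_step/step_right/rule_mark.
apply: (@reach_le_trans (at_head (Ctrl ConvertLeft) l1 r1)).
  rewrite /w map_cat /= -!map_comp.
  by apply: (reach_right (f := fun b => Letter b)) => b _; apply: rule_left.
apply: (@reach_le_trans (at_head (Ctrl ConvertRight) (Cell ee :: l1)
    (map (fun b => Letter b) v))).
  exact/reach_le_step/step_right/rule_hash.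
apply: (@reach_le_trans (at_head (Ctrl ConvertRight) l2 [::])).
  rewrite -[map _ v]cats0.
  by apply: (reach_right (f := fun b => Letter b)) => b _; apply: rule_right.
apply: (@reach_le_trans (at_head (Ctrl ConvertRight) (nseq k (Cell ee) ++ l2) [::])).
  elim: (k) (l2) => [|k' IH] l; first exact: reach_le_refl.
  apply: (@reach_le_trans (at_head (Ctrl ConvertRight) (Cell ee :: l) [::]) 1).
    by apply: reach_le_step; apply: (@step_right _ Blank); apply: rule_pad.
  have := IH (Cell ee :: l); congr (reach_le _ _ (at_head _ _ _)).
  by elim: (k') => //= k'' ->.
set cs := map _ u ++ _.
have -> : nseq k (Cell ee) ++ l2 = cells (rev cs) ++ [:: Hash].
  rewrite /cs /l2 /l1 rev_cat rev_cons rev_cat -!map_rev rev_nseq map_cat map_rcons.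
  by rewrite map_cat map_nseq -!map_comp cat_rcons -!catA.
have := reach_home (rev cs) [::] rule_ready; rewrite revK.
suff -> : size (rev cs) = n + k by [].
by rewrite size_rev /cs size_cat /= size_cat !size_map size_nseq /n; lia.
Qed.

(** ** Simulating derivations *)

Section Padding.
Variables (N k : nat) (conf : seq W -> config machine).
Hypothesis conf_pair : forall x y c d c' d', val c ** val d = val c' ** val d' ->
  size x + size y + 2 = N ->
  reach_le k (conf (x ++ c :: d :: y)) (conf (x ++ c' :: d' :: y)).

(** The tape cannot grow in the middle, so a list is kept at exactly [N] cells, with the spare
    neutral cells at its end. *)
Definition pad (s : seq W) : seq W := s ++ nseq (N - size s) e.

(** A neutral cell commutes with its neighbour in one pair step, so inserting or deleting [e]
    amounts to moving it from or to the padding. *)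
Lemma reach_bubble x y z : size x + size y + size z + 1 = N ->
  reach_le (size y * k) (conf (x ++ e :: y ++ z)) (conf (x ++ y ++ e :: z)) /\
  reach_le (size y * k) (conf (x ++ y ++ e :: z)) (conf (x ++ e :: y ++ z)).
Proof.
elim: y x => [|c y IH] x /= sN; first by split; apply: reach_le_refl.
have [|IH1 IH2] := IH (rcons x c); first by rewrite size_rcons; lia.
rewrite !cat_rcons in IH1 IH2; split.
  apply: reach_le_trans IH1; apply: conf_pair; last by rewrite size_cat; lia.
  by rewrite val_e (mul1m monM) (mulm1 monM).
rewrite mulSn addnC; apply: reach_le_trans IH2 _.
apply: conf_pair; last by rewrite size_cat; lia.
by rewrite val_e (mul1m monM) (mulm1 monM).
Qed.

(** Both directions are carried through the induction because derivations are symmetric while runs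
    are not. *)
Lemma reach_der m s t : der mul val e N m s t ->
  [/\ size s <= N, size t <= N,
      reach_le (m * (N * k)) (conf (pad s)) (conf (pad t)) &
      reach_le (m * (N * k)) (conf (pad t)) (conf (pad s))].
Proof.
elim=> {m s t}.
- by move=> s sN; split=> //; apply: reach_le_refl.
- move=> m m' s t _ [sN tN st ts] lem.
  by split=> //; [apply: reach_le_weaken st|apply: reach_le_weaken ts];
    rewrite leq_mul2r lem orbT.
- move=> m m' s t u _ [sN _ st ts] _ [_ uN tu ut]; rewrite mulnDl.
  by split=> //; [apply: reach_le_trans st tu|rewrite addnC; apply: reach_le_trans ut ts].
- by move=> m s t _ [].
- move=> x c d c' d' y cd sN; rewrite /pad !size_cat /= mul1n -!catA /=.
  have kN : k <= N * k by rewrite leq_pmull //; lia.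
  have lenN : size x + size (y ++ nseq (N - (size x + (size y).+2)) e) + 2 = N.
    by rewrite size_cat size_nseq; lia.
  have szN : size x + (size y).+2 <= N by lia.
  by split; try exact: szN; apply: (reach_le_weaken kN); apply: conf_pair lenN.
- move=> x y sN; rewrite /pad !size_cat /= mul1n -!catA /=.
  set z := nseq (N - (size x + (size y).+1)) e.
  have -> : nseq (N - (size x + size y)) e = e :: z.
    rewrite /z -[e :: nseq _ e]/(nseq _.+1 e); congr nseq; lia.
  have [|H1 H2] := @reach_bubble x y z; first by rewrite size_nseq; lia.
  have yN : size y * k <= N * k by rewrite leq_mul2r; apply/orP; right; lia.
  by split; [lia|lia|exact: reach_le_weaken H2|exact: reach_le_weaken H1].
Qed.

End Padding.
Lemma reach_pair1 b x y c d c' d' : val c ** val d = val c' ** val d' ->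
  size x + size y + 2 = size b ->
  reach_le (2 * size b + 4) (home (zip (x ++ c :: d :: y) b))
    (home (zip (x ++ c' :: d' :: y) b)).
Proof.
move=> cd sb; rewrite -{2 3}(cat_take_drop (size x) b).
have stb : size (take (size x) b) = size x by rewrite size_takel //; lia.
have := size_drop (size x) b.
case: (drop _ b) => [|b1 [|b2 b']] /= sd; [lia|lia|].
rewrite !zip_cat //; apply: (reach_le_weaken _ (reach_rewrite _ _ _)).
  by rewrite size_zip stb minnn; lia.
by rewrite /mul2 /= cd.
Qed.

Lemma reach_pair2 b x y c d c' d' : val c ** val d = val c' ** val d' ->
  size x + size y + 2 = size b ->
  reach_le (2 * size b + 4) (home (zip b (x ++ c :: d :: y)))
    (home (zip b (x ++ c' :: d' :: y))).
Proof.
move=> cd sb; rewrite -{2 3}(cat_take_drop (size x) b).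
have stb : size (take (size x) b) = size x by rewrite size_takel //; lia.
have := size_drop (size x) b.
case: (drop _ b) => [|b1 [|b2 b']] /= sd; [lia|lia|].
rewrite !zip_cat //; apply: (reach_le_weaken _ (reach_rewrite _ _ _)).
  by rewrite size_zip stb minnn; lia.
by rewrite /mul2 /= cd.
Qed.

Lemma machine_complete u v s N m :
  der mul val e N m (map cell u ++ nseq (size v + 1) e) s ->
  der mul val e N m (nseq (size u + 1) e ++ map cell v) s ->
  accepts_within machine (map Some u ++ None :: map Some v)
    (3 * N + 5 + 2 * (m * (N * (2 * N + 4)))).
Proof.
move=> du dv.
have size_pad t : size t <= N -> size (pad N t) = N.
  by move=> tN; rewrite size_cat size_nseq subnKC.
have top b : size b = N -> reach_le (m * (N * (2 * N + 4)))
    (home (zip (pad N (map cell u ++ nseq (size v + 1) e)) b)) (home (zip (pad N s) b)).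
  move=> sb; have [|] := @reach_der N (2 * N + 4) (fun t => home (zip t b)) _ _ _ _ du.
    by move=> x y c d c' d'; rewrite -sb; apply: reach_pair1.
  by [].
have bottom b : size b = N -> reach_le (m * (N * (2 * N + 4)))
    (home (zip b (pad N (nseq (size u + 1) e ++ map cell v)))) (home (zip b (pad N s))).
  move=> sb; have [|] := @reach_der N (2 * N + 4) (fun t => home (zip b t)) _ _ _ _ dv.
    by move=> x y c d c' d'; rewrite -sb; apply: reach_pair2.
  by [].
(* With a constant configuration [reach_der] serves only for its size bounds. *)
have [vN sN] : size (nseq (size u + 1) e ++ map cell v) <= N /\ size s <= N.
  have [|] := @reach_der N 0 (fun=> home [::]) _ _ _ _ dv => //.
  by move=> *; apply: reach_le_refl.
have uN : size u + size v + 1 <= N.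
  by move: vN; rewrite size_cat size_nseq size_map; lia.
have [c rc ca] : exists2 c, reach_le (N + 2) (home (zip (pad N s) (pad N s))) c &
    c.1.1.1 = tm_accept machine.
  have -> : N + 2 = size (zip (pad N s) (pad N s)) + 2.
    by rewrite size_zip size_pad // minnn.
  by apply: reach_accept; elim: (pad N s) => //= a t IH c /predU1P [->|/IH].
suff [n lenN rn] : reach_le (3 * N + 5 + 2 * (m * (N * (2 * N + 4))))
    (init_config machine (map Some u ++ None :: map Some v)) c by exists n, c.
apply: (@reach_le_weaken ((2 * N + 3) +
   (m * (N * (2 * N + 4)) + (m * (N * (2 * N + 4)) + (N + 2))))); first by lia.
apply: reach_le_trans (reach_le_trans (top (pad N (nseq (size u + 1) e ++ map cell v)) _)
  (reach_le_trans (bottom (pad N s) _) rc)); rewrite ?size_pad //.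
(* This amount of padding makes the tape exactly [N] cells long. *)
have := reach_convert u v (N - (size u + size v + 1)).
rewrite subnKC //; congr (reach_le _ _ (home (zip _ _))).
  rewrite /pad -catA -nseqD; congr (_ ++ nseq (_ + _) e).
  by rewrite size_cat size_map size_nseq addnA.
rewrite /pad -catA; congr (_ ++ (_ ++ nseq _ e)).
by rewrite size_cat size_map size_nseq; lia.
Qed.
End Machine.

(** * Polynomial bounds and conclusion *)

Lemma polynomial_time_bound C j :
  exists k, forall n, 0 < n -> C * n ^ j <= n ^ k + k.
Proof.
(* For a base of at least 2 the power with exponent [C] exceeds [C] and absorbs the factor; the base
   1 is covered by the summand [k]. *)
exists (C + j) => -[//|[|n]] _; first by rewrite !exp1n; lia.
rewrite expnD; apply: leq_trans (leq_addr _ _).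
by rewrite leq_mul2r ltnW ?orbT // ltn_expl.
Qed.

Lemma running_time_bound K0 n S N m : 0 < n ->
  S = K0 * n -> N = 2 * S + n + 4 -> m = n.+1 * ((S + 2) * (2 * S + 5) + 1) ->
  3 * N + 5 + 2 * (m * (N * (2 * N + 4))) <= 16 * (2 * K0 + 5) ^ 5 * n ^ 5.
Proof.
move=> n0 SE NE mE; rewrite -mulnA -expnMn; set X := (2 * K0 + 5) * n.
have XE : X = 2 * S + 5 * n by rewrite /X mulnDl -mulnA SE.
have NX : N <= X by lia.
have mX : m <= X * (2 * (X * X)).
  rewrite mE leq_mul //; first by lia.
  rewrite mulSn mul1n leq_add ?muln_gt0 ?leq_mul //; lia.
have NX2 : N * (2 * N + 4) <= X * (3 * X) by rewrite leq_mul //; lia.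
have := leq_mul mX NX2.
have -> : X * (2 * (X * X)) * (X * (3 * X)) = 6 * X ^ 5 by rewrite !expnS expn0; lia.
have : X * 1 <= X * X ^ 4 by rewrite leq_mul2l expn_gt0; lia.
rewrite -expnS; lia.
Qed.

Unset Implicit Arguments.

Theorem theorem5p7 (M : Type) (mul : M -> M -> M) (one : M)
  (Hmon : is_monoid mul one) (Hlc : left_cancellative mul)
  (A : finType) (genA : A -> M) (HA : generates mul one genA)
  (delta : R) (Hdelta : Rle 0 delta)
  (Hhyp : strongly_hyperbolic mul genA delta) :
  forall (B : finType) (genB : B -> M), generates mul one genB ->
    in_NP (word_problem mul one genB).
Proof.
move=> B genB _.
have [D dD] := INR_bounded delta.
have [wB wBE] : exists wB : B -> seq A, forall b, word_eval mul one genA (wB b) = genB b.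
  exact: (fin_all_exists (fun b => HA (genB b))).
(* Hyperbolicity concerns [A] but the input is over [B]: a letter of [B] becomes one cell holding a
   word over [A] of length at most [K0]. *)
pose K0 := \max_b size (wB b).
pose K := 2 * (2 * D + K0 + 2) + 2 * D + 1.
pose W : finType := K.-bseq A.
pose val (c : W) := word_eval mul one genA c.
pose cell b : W := insub_bseq K (wB b).
pose letter a : W := insub_bseq K [:: a].
have val_e : val [bseq] = one by [].
(* The default of [insub_bseq] on words longer than [K] is the empty word, so the length bound
   matters. *)
have valE w : size w <= K -> val (insub_bseq K w) = word_eval mul one genA w.
  by move=> sw; rewrite /val /insub_bseq insubdK.
have sB b : size (wB b) <= K0 by apply: leq_bigmax.
have val_cell b : val (cell b) = genB b.
  by rewrite valE // (leq_trans (sB b)) // /K; lia.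
have val_letter a : val (letter a) = genA a.
  by rewrite valE ?ev1 //= /K; lia.
have cellK m : ball mul one genA K m -> exists c, val c = m.
  by move=> [w sw <-]; exists (insub_bseq K w); apply: valE.
have [k kP] := polynomial_time_bound (16 * (2 * K0 + 5) ^ 5) 5.
exists (machine mul val [bseq] cell), k => w; split; last first.
  exact: machine_sound.
move=> [u [v [wE uv]]].
(* Both tracks will be rewritten to this one geodesic, and then agree cell by cell. *)
have [g gg gE] := geodesic_exists (word_eval mul one genB u) HA.
have n0 : 0 < size w by rewrite wE size_cat /=; lia.
have sw : size w = size u + size v + 1 by rewrite wE size_cat /= !size_map; lia.
have reduce cs : size cs = size w ->
    (forall c, List.In c cs -> c = [bseq] \/ exists b, c = cell b) ->
    word_eval mul one val cs = word_eval mul one genB u ->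
    der mul val [bseq] (2 * (K0 * size w) + size w + 4)
      ((size w).+1 * ((K0 * size w + 2) * (2 * (K0 * size w) + 5) + 1))
      cs (map letter g).
  move=> scs csP csE; rewrite -scs.
  (* The reduction starts from the empty geodesic, so [K0] times the number of cells serves as
     [S]. *)
  apply: (@der_reduce _ _ _ Hmon Hlc _ _ HA _ _ dD Hhyp _ val [bseq] letter
    val_e val_letter K0 cellK cs [::] g) => //.
  - move=> c /csP [->|[b ->]]; first exact: ball_one.
    by rewrite val_cell -wBE; exists (wB b).
  - by rewrite mul1m // -[foldr _ _ _]/(word_eval mul one val cs) csE.
have eval_e n : word_eval mul one val (nseq n [bseq]) = one.
  by elim: n => //= n ->; rewrite val_e mul1m.
have eval_cell x : word_eval mul one val (map cell x) = word_eval mul one genB x.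
  by elim: x => //= b x ->; rewrite val_cell.
have in_e n c : List.In c (nseq n [bseq]) -> c = [bseq] :> W.
  by elim: n => //= n IH [|/IH].
have in_cell x c : List.In c (map cell x) -> exists b, c = cell b.
  by elim: x => //= b x IH [<-|/IH //]; exists b.
have du : der mul val [bseq] (2 * (K0 * size w) + size w + 4)
    ((size w).+1 * ((K0 * size w + 2) * (2 * (K0 * size w) + 5) + 1))
    (map cell u ++ nseq (size v + 1) [bseq]) (map letter g).
  apply: reduce.
  - by rewrite size_cat size_map size_nseq sw addnA.
  - by move=> c /(@List.in_app_or W) [/in_cell|/in_e]; [right|left].
  - by rewrite ev_cat // eval_cell eval_e mulm1.
have dv : der mul val [bseq] (2 * (K0 * size w) + size w + 4)
    ((size w).+1 * ((K0 * size w + 2) * (2 * (K0 * size w) + 5) + 1))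
    (nseq (size u + 1) [bseq] ++ map cell v) (map letter g).
  apply: reduce.
  - by rewrite size_cat size_map size_nseq sw; lia.
  - by move=> c /(@List.in_app_or W) [/in_e|/in_cell]; [left|right].
  - by rewrite ev_cat // eval_cell eval_e mul1m.
have [t [c [tle rc]]] := machine_complete Hmon val_e du dv.
exists t, c; split; last by rewrite wE.
apply: leq_trans tle (leq_trans _ (kP _ n0)).
exact: running_time_bound.
Qed.
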